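(* For every integer $n \ge 1$, the $f$-vector of the cellular diagonal $\Delta_{n-1}$ of the $(n-1)$-dimensional associahedron is $(b_{n,k})_{0 \le k < n}$, where $b_{n,k}$ denotes the sum of the binomial coefficients $\binom{\mathrm{des}(S)+\mathrm{asc}(T)}{k}$ over all intervals $S \le T$ of the Tamari lattice $\mathrm{Tam}(n)$.
   Context: Tamari lattice. $\mathrm{Tam}(n)$ is the lattice whose elements are the (rooted, plane) binary trees with $n$ nodes, and whose cover relations are right rotations: $T'$ covers $T$ if $T'$ is obtained from $T$ by replacing a subtree of the form (node $j$ with left child $i$, where $i$ has subtrees $A,B$ and $j$ has right subtree $C$) by (node $i$ with left subtree $A$ and right child $j$, where $j$ has subtrees $B,C$). For a binary tree $T$, $\mathrm{des}(T)$ (resp. $\mathrm{asc}(T)$) is the number of binary trees covered by $T$ (resp. covering $T$) in $\mathrm{Tam}(n)$. Associahedron. The faces of the $d$-dimensional associahedron correspond to Schröder trees with $d+2$ leaves (rooted plane trees in which every internal node has at least two children); the face of a Schröder tree with $m$ internal nodes has dimension $d+1-m$. The vertices correspond to binary trees with $d+1$ nodes (hence $d+2$ leaves), and face inclusion corresponds to edge contraction of Schröder trees. The associahedron is a simple polytope, and its oriented graph is the Hasse diagram of $\mathrm{Tam}(d+1)$. Each face $F$ has a minimum vertex $\min(F)$ and a maximum vertex $\max(F)$ for the Tamari order: they are obtained by replacing each $p$-ary node of the Schröder tree by a left comb (resp. right comb) with $p$ leaves. Cellular diagonal. A cellular diagonal of a polytope $P$ is a map $P \to P \times P$ homotopic to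 $x \mapsto (x,x)$, agreeing with it on the vertices of $P$, and whose image is a union of faces of $P \times P$. $\Delta_d$ denotes the cellular diagonal of the $d$-dimensional associahedron (in Loday's realization) constructed by Masuda, Thomas, Tonks and Vallette; it is viewed as a polytopal complex. Its faces are given by the known ''magical formula'': the $k$-dimensional faces of $\Delta_d$ correspond to the pairs $(F,G)$ of faces of the $d$-dimensional associahedron such that $\dim(F)+\dim(G)=k$ and $\max(F) \le \min(G)$ in the Tamari lattice. The $f$-vector of a $d$-dimensional polytopal complex is $(f_0,\dots,f_d)$, where $f_i$ is its number of $i$-dimensional faces. *)

(* Defs.v *)
From HB Require Import structures.
From mathcomp Require Import all_boot all_order.

Set Implicit Arguments.
Unset Strict Implicit.
Unset Printing Implicit Defensive.

Import Order.TTheory.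

Section BoundedEnum.

Variables (T : countType) (P : pred T) (e : seq T).
Hypothesis eP : forall x, P x -> x \in e.

Definition bounded_enum : seq {x | P x} := undup (pmap insub e).

Lemma bounded_enumP : Finite.axiom bounded_enum.
Proof.
move=> x; rewrite count_uniq_mem ?undup_uniq // mem_undup mem_pmap_sub.
by rewrite eP ?(valP x).
Qed.

End BoundedEnum.

Inductive bintree : Type := Leaf | Node of bintree & bintree.

Fixpoint bt_encode (t : bintree) : GenTree.tree unit :=
  if t is Node l r then GenTree.Node 1 [:: bt_encode l; bt_encode r]
  else GenTree.Node 0 [::].

Fixpoint bt_decode (g : GenTree.tree unit) : option bintree :=
  match g with
  | GenTree.Node 0 [::] => Some Leaf
  | GenTree.Node 1 [:: g1; g2] =>
      if (bt_decode g1, bt_decode g2) is (Some l, Some r)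
      then Some (Node l r) else None
  | _ => None
  end.

Lemma bt_encodeK : pcancel bt_encode bt_decode.
Proof. by elim=> //= l -> r ->. Qed.

HB.instance Definition _ := Countable.copy bintree (pcan_type bt_encodeK).

Fixpoint nodes (t : bintree) : nat :=
  if t is Node l r then (nodes l + nodes r).+1 else 0.

(** [rotation t u]: [u] is obtained from [t] by one right rotation, performed
    either at the root or inside one of the two subtrees. *)
Fixpoint rotation (t u : bintree) : bool :=
  match t, u with
  | Node l r, Node l' r' =>
      [|| if l is Node a b then (l' == a) && (r' == Node b r) else false,
          rotation l l' && (r == r')
        | (l == l') && rotation r r']
  | _, _ => false
  end.

Lemma nodes_rotation t u : rotation t u -> nodes t = nodes u.
Proof.
elim: t u => [|l IHl r IHr] [|l' r'] //= /or3P[||].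
- by case: l {IHl} => // a b /andP[/eqP-> /eqP->] /=; rewrite addSn addnS addnA.
- by case/andP=> /IHl-> /eqP->.
- by case/andP=> /eqP-> /IHr->.
Qed.

Fixpoint right_weight (t : bintree) : nat :=
  if t is Node l r then right_weight l + right_weight r + nodes r else 0.

Lemma right_weight_rotation t u :
  rotation t u -> right_weight t < right_weight u.
Proof.
elim: t u => [|l IHl r IHr] [|l' r'] //= /or3P[||].
- case: l {IHl} => // a b /andP[/eqP-> /eqP->] /=.
  rewrite addnS ltnS !addnA leq_add2r (addnAC _ (nodes b)) leq_add2r.
  exact: leq_addr.
- by case/andP=> /IHl lt_l /eqP->; rewrite !ltn_add2r.
- case/andP=> /eqP-> rot_r; rewrite (nodes_rotation rot_r) ltn_add2r.
  by rewrite ltn_add2l IHr.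
Qed.

Definition Tam (n : nat) : Type := {t : bintree | nodes t == n}.

HB.instance Definition _ n := Countable.on (Tam n).

Fixpoint bintrees (k : nat) : seq bintree :=
  if k is k'.+1 then Leaf :: [seq Node l r | l <- bintrees k', r <- bintrees k']
  else [:: Leaf].

Lemma mem_bintrees k t : nodes t <= k -> t \in bintrees k.
Proof.
elim: k t => [|k IHk] [|l r] //=; rewrite ltnS => le_k.
rewrite inE /=; apply: allpairs_f; apply: IHk; apply: leq_trans le_k.
  exact: leq_addr.
exact: leq_addl.
Qed.

Lemma Tam_enumP n : Finite.axiom (bounded_enum (fun t => nodes t == n) (bintrees n)).
Proof. by apply: bounded_enumP => t /eqP <-; exact: mem_bintrees. Qed.

HB.instance Definition _ n := isFinite.Build (Tam n) (@Tam_enumP n).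

Definition tam_rotation n : rel (Tam n) := fun S T => rotation (val S) (val T).

Definition tam_le n : rel (Tam n) := connect (@tam_rotation n).

Lemma tam_le_refl n : reflexive (@tam_le n).
Proof. by move=> T; exact: connect0. Qed.

Lemma tam_le_trans n : transitive (@tam_le n).
Proof. exact: connect_trans. Qed.

Lemma tam_le_weight n (S T : Tam n) :
  tam_le S T -> S = T \/ right_weight (val S) < right_weight (val T).
Proof.
case/connectP=> p; elim: p S => [|U p IHp] S /=; first by move=> _ ->; left.
case/andP=> /right_weight_rotation lt_SU /IHp/[apply] [[<-|lt_UT]]; right=> //.
exact: ltn_trans lt_UT.
Qed.

Lemma tam_le_anti n : antisymmetric (@tam_le n).
Proof.
move=> S T /andP[/tam_le_weight[//|lt_ST] /tam_le_weight[//|lt_TS]].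
by have:= ltn_trans lt_ST lt_TS; rewrite ltnn.
Qed.

Fact tamari_display : Order.disp_t. Proof. exact: Order.Disp tt tt. Qed.

HB.instance Definition _ n :=
  Order.Le_isPOrder.Build tamari_display (Tam n)
    (@tam_le_refl n) (@tam_le_anti n) (@tam_le_trans n).

Definition des n (T : Tam n) : nat := #|[set S : Tam n | tam_rotation S T]|.

Definition asc n (T : Tam n) : nat := #|[set U : Tam n | tam_rotation T U]|.

(** The children of [SNode s1 s2 ss] are, from left to right, [s1], [s2] and
    the elements of [ss]: every internal node has at least two children. *)
Inductive stree : Type := SLeaf | SNode of stree & stree & seq stree.

Fixpoint stree_ind_all (P : stree -> Prop) (P0 : P SLeaf)
    (PN : forall s1 s2 ss, P s1 -> P s2 -> foldr and True (map P ss) ->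
          P (SNode s1 s2 ss)) (s : stree) : P s :=
  if s is SNode s1 s2 ss then
    PN s1 s2 ss (stree_ind_all P0 PN s1) (stree_ind_all P0 PN s2)
      ((fix all_in (ss : seq stree) : foldr and True (map P ss) :=
          if ss is u :: us then conj (stree_ind_all P0 PN u) (all_in us)
          else I) ss)
  else P0.

Fixpoint st_encode (s : stree) : GenTree.tree unit :=
  if s is SNode s1 s2 ss then
    GenTree.Node 1 [:: st_encode s1, st_encode s2 & map st_encode ss]
  else GenTree.Node 0 [::].

Fixpoint st_decode (g : GenTree.tree unit) : stree :=
  if g is GenTree.Node 1 [:: g1, g2 & gs] then
    SNode (st_decode g1) (st_decode g2) (map st_decode gs)
  else SLeaf.

Lemma st_encodeK : cancel st_encode st_decode.
Proof.
elim/stree_ind_all=> //= s1 s2 ss -> -> IHss; congr SNode.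
by elim: ss IHss => //= s ss IH [-> /IH->].
Qed.

HB.instance Definition _ := Countable.copy stree (can_type st_encodeK).

Lemma stree_ind_mem (P : stree -> Prop) :
    P SLeaf ->
    (forall s1 s2 ss, P s1 -> P s2 -> {in ss, forall s, P s} ->
       P (SNode s1 s2 ss)) ->
  forall s, P s.
Proof.
move=> P0 PN; elim/stree_ind_all=> // s1 s2 ss P1 P2 Pss; apply: PN => // s.
by elim: ss Pss => //= u us IH [Pu /IH Pus]; rewrite inE => /predU1P[->|].
Qed.

Fixpoint leaves (s : stree) : nat :=
  if s is SNode s1 s2 ss then leaves s1 + leaves s2 + sumn (map leaves ss)
  else 1.

Fixpoint internal_nodes (s : stree) : nat :=
  if s is SNode s1 s2 ss then
    (internal_nodes s1 + internal_nodes s2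
       + sumn (map internal_nodes ss)).+1
  else 0.

(** [left_comb t1 [:: t2; ...; tp]] is ((t1 t2) t3 ...) tp, and [right_comb]
    on the same arguments is t1 (t2 (... tp)). *)
Definition left_comb (t : bintree) (ts : seq bintree) : bintree :=
  foldl Node t ts.

Fixpoint right_comb (t : bintree) (ts : seq bintree) : bintree :=
  if ts is u :: us then Node t (right_comb u us) else t.

Fixpoint min_tree (s : stree) : bintree :=
  if s is SNode s1 s2 ss then
    left_comb (min_tree s1) (min_tree s2 :: map min_tree ss)
  else Leaf.

Fixpoint max_tree (s : stree) : bintree :=
  if s is SNode s1 s2 ss then
    right_comb (max_tree s1) (max_tree s2 :: map max_tree ss)
  else Leaf.

Lemma nodes_left_comb t ts :
  (nodes (left_comb t ts)).+1
    = (nodes t).+1 + sumn [seq (nodes u).+1 | u <- ts].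
Proof.
rewrite /left_comb; elim: ts t => [|u us IH] t /=; first by rewrite addn0.
by rewrite IH /= addnA addSn addnS.
Qed.

Lemma nodes_right_comb t ts :
  (nodes (right_comb t ts)).+1
    = (nodes t).+1 + sumn [seq (nodes u).+1 | u <- ts].
Proof.
elim: ts t => [|u us IH] t /=; first by rewrite addn0.
by rewrite -IH addSn addnS.
Qed.

Lemma nodes_min_tree s : (nodes (min_tree s)).+1 = leaves s.
Proof.
elim/stree_ind_mem: s => // s1 s2 ss IH1 IH2 IHss.
rewrite [LHS]nodes_left_comb /= IH1 IH2 addnA -map_comp.
by congr (_ + sumn _); apply/eq_in_map.
Qed.

Lemma nodes_max_tree s : (nodes (max_tree s)).+1 = leaves s.
Proof.
elim/stree_ind_mem: s => // s1 s2 ss IH1 IH2 IHss.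
rewrite [LHS](nodes_right_comb _ (_ :: _)) /= IH1 IH2 addnA -map_comp.
by congr (_ + sumn _); apply/eq_in_map.
Qed.

Definition assoc_face (d : nat) : Type := {s : stree | leaves s == d.+2}.

HB.instance Definition _ d := Countable.on (assoc_face d).

Fixpoint short_seqs (T : Type) (k : nat) (e : seq T) : seq (seq T) :=
  if k is k'.+1 then [::] :: [seq x :: s | x <- e, s <- short_seqs k' e]
  else [:: [::]].

Lemma mem_short_seqs (T : eqType) k (e s : seq T) :
  size s <= k -> {subset s <= e} -> s \in short_seqs k e.
Proof.
elim: k s => [|k IHk] [|x s] //= le_k sub_e.
rewrite inE /=; apply: allpairs_f; first by apply: sub_e; rewrite mem_head.
by apply: IHk => // y s_y; apply: sub_e; rewrite inE s_y orbT.
Qed.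

Fixpoint strees (k : nat) : seq stree :=
  if k is k'.+1 then
    SLeaf :: [seq SNode s.1 s.2 ss |
                s <- [seq (s1, s2) | s1 <- strees k', s2 <- strees k'],
                ss <- short_seqs k' (strees k')]
  else [:: SLeaf].

Lemma leaves_gt0 s : 0 < leaves s.
Proof. by rewrite -nodes_min_tree. Qed.

Lemma leq_leaves_sumn s ss : s \in ss -> leaves s <= sumn (map leaves ss).
Proof.
elim: ss => //= u us IH; rewrite inE => /predU1P[->|/IH le_s].
  exact: leq_addr.
exact: leq_trans le_s (leq_addl _ _).
Qed.

Lemma size_leaves ss : size ss <= sumn (map leaves ss).
Proof.
elim: ss => //= s ss IH; rewrite -add1n.
exact: leq_add (leaves_gt0 s) IH.
Qed.

Lemma mem_strees k s : leaves s <= k.+1 -> s \in strees k.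
Proof.
elim: k s => [|k IHk] [|s1 s2 ss] //= le_k.
  have := leq_trans (leq_addr _ _) le_k.
  by rewrite leqNgt (leq_add (leaves_gt0 s1) (leaves_gt0 s2)).
have gt1 := leaves_gt0 s1; have gt2 := leaves_gt0 s2.
have le_ss : sumn (map leaves ss) <= k.
  rewrite -(leq_add2l 2); apply: leq_trans le_k.
  by rewrite leq_add2r (leq_add gt1 gt2).
have le1 : leaves s1 <= k.+1.
  rewrite -ltnS; apply: leq_trans le_k; rewrite -addnA -addn1 leq_add2l.
  exact: leq_trans gt2 (leq_addr _ _).
have le2 : leaves s2 <= k.+1.
  rewrite -ltnS; apply: leq_trans le_k; apply: leq_trans (leq_addr _ _).
  by rewrite -add1n leq_add2r.
rewrite inE /=; apply/allpairsP; exists ((s1, s2), ss); split=> //=.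
  by apply: allpairs_f; exact: IHk.
apply: mem_short_seqs => [|s ss_s]; first exact: leq_trans (size_leaves ss) le_ss.
by apply: IHk; apply: leq_trans (leq_leaves_sumn ss_s) (leq_trans le_ss _).
Qed.

Lemma assoc_face_enumP d :
  Finite.axiom (bounded_enum (fun s => leaves s == d.+2) (strees d.+1)).
Proof. by apply: bounded_enumP => s /eqP eq_s; apply: mem_strees; rewrite eq_s. Qed.

HB.instance Definition _ d := isFinite.Build (assoc_face d) (@assoc_face_enumP d).

(** Never truncated: [s] with [d.+2] leaves has at most [d.+1] internal nodes. *)
Definition face_dim d (F : assoc_face d) : nat := d.+1 - internal_nodes (val F).

Lemma face_minP d (F : assoc_face d) : nodes (min_tree (val F)) == d.+1.
Proof. by rewrite -eqSS nodes_min_tree (valP F). Qed.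

Lemma face_maxP d (F : assoc_face d) : nodes (max_tree (val F)) == d.+1.
Proof. by rewrite -eqSS nodes_max_tree (valP F). Qed.

Definition face_min d (F : assoc_face d) : Tam d.+1 :=
  exist _ (min_tree (val F)) (face_minP F).

Definition face_max d (F : assoc_face d) : Tam d.+1 :=
  exist _ (max_tree (val F)) (face_maxP F).

(** The cells of the diagonal of the [d]-dimensional associahedron, encoded
    through the magical formula of Masuda, Thomas, Tonks and Vallette: a cell
    is a product F x G of two faces of the associahedron such that
    max F <= min G in the Tamari order. *)
Definition diag_face (d : nat) : Type :=
  {FG : assoc_face d * assoc_face d | (face_max FG.1 <= face_min FG.2)%O}.

HB.instance Definition _ d := Finite.on (diag_face d).

Definition diag_dim d (C : diag_face d) : nat :=
  face_dim (val C).1 + face_dim (val C).2.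

Definition diag_fvector (d : nat) : seq nat :=
  mkseq (fun k => #|[set C : diag_face d | diag_dim C == k]|) d.+1.

Definition tamari_b (n k : nat) : nat :=
  \sum_(I : Tam n * Tam n | (I.1 <= I.2)%O) 'C(des I.1 + asc I.2, k).

(* Main.v *)
Require Import Defs.
From mathcomp Require Import all_boot all_order.
From mathcomp Require Import ssralg poly.

Set Implicit Arguments.
Unset Strict Implicit.
Unset Printing Implicit Defensive.

Import GRing.Theory.

(** The theorem is an identity of f-polynomials: the sum of X^(dim C) over the
    cells C of the diagonal is the sum of (1 + X)^(des S + asc T) over the
    intervals S <= T ([diag_polynomial]), and the entries of the f-vector are
    its coefficients.

    A cell is a pair (F, G) with max F <= min G. Group the cells by the interval
    (max F, min G): for a given interval (S, T) the faces F and G are chosen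
    independently among the faces with maximum S and those with minimum T. So
    it suffices that the faces with maximum S have f-polynomial (1 + X)^(des S)
    ([sum_face_max]), and those with minimum T have f-polynomial
    (1 + X)^(asc T) ([sum_face_min]).

    A Schroeder tree with maximum S arises from S by contracting an arbitrary
    set of right edges (edges from an internal node to an internal right
    child), since replacing each node by a right comb undoes exactly these
    contractions; each contraction raises the dimension by one. The right edges
    of S are also the places where a right rotation may end, so there are des S
    of them ([des_right_edges]). Minima are treated in the same way with left
    edges, which are the places where a rotation may start ([asc_left_edges]).

    The choice of the contracted edges is made recursively: [fiber] lists the
    Schroeder trees with maximum S = Node l r by combining one with maximum l
    and one with maximum r, and then keeping or contracting the edge at the
    root. The two
    sides differ only in the operation that contracts the root edge, so both
    are instances of the same argument. *)

(** Trees of a fixed size form a finite type, but recursion on trees changes the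
    size: this turns a count or sum over the finite type into one over a list of
    trees without size constraint. *)
Lemma perm_map_enum (S : finType) (T : eqType) (f : S -> T) (Q : pred T)
    (e : seq T) :
    injective f -> uniq e -> e =i Q -> {in e, forall x, exists y, f y = x} ->
  perm_eq [seq f y | y <- enum [pred y | Q (f y)]] e.
Proof.
move=> f_inj e_uniq mem_e e_f; apply: uniq_perm => // [|x].
  by rewrite map_inj_uniq ?enum_uniq.
apply/mapP/idP => [[y + ->]|e_x]; first by rewrite mem_enum mem_e.
have [y def_x] := e_f x e_x; exists y => //.
by rewrite mem_enum inE def_x -[Q x]mem_e.
Qed.

(** * Edges of a binary tree and covers in the Tamari lattice *)

(** [edge l r] tells whether the root of [Node l r] has an internal child on the
    side under consideration. *)
Fixpoint count_edges (edge : bintree -> bintree -> bool) (t : bintree) : nat :=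
  if t is Node l r then edge l r + count_edges edge l + count_edges edge r
  else 0.

Definition left_edge (l r : bintree) : bool := l != Leaf.

Definition right_edge (l r : bintree) : bool := r != Leaf.

Lemma eq_Node l r l' r' :
  (Node l r == Node l' r') = (l == l') && (r == r').
Proof.
by apply/eqP/andP => [[-> ->]|[/eqP-> /eqP->]].
Qed.

(** Right rotations and inverse right rotations are the same kind of local
    move: at most one at each node, present exactly when the node has an edge on
    the relevant side. The section counts the moves of a tree for an arbitrary
    rule [root_moves] applied at the root. *)
Section Moves.

Variables (root_moves : bintree -> bintree -> seq bintree).
Variable edge : bintree -> bintree -> bool.

Hypothesis size_root_moves : forall l r, size (root_moves l r) = edge l r.
Hypothesis root_moves_proper : forall l r l' r',
  Node l' r' \in root_moves l r -> (l' != l) && (r' != r).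
Hypothesis Leaf_root_moves : forall l r, Leaf \notin root_moves l r.

Fixpoint moves (t : bintree) : seq bintree :=
  if t is Node l r then
    root_moves l r ++ [seq Node l' r | l' <- moves l]
      ++ [seq Node l r' | r' <- moves r]
  else [::].

Lemma mem_Node_left l r r0 (s : seq bintree) :
  (Node l r \in [seq Node l' r0 | l' <- s]) = (l \in s) && (r == r0).
Proof.
apply/mapP/andP => [[l' s_l' [-> ->]]|[s_l /eqP->]]; first by [].
by exists l.
Qed.

Lemma mem_Node_right l r l0 (s : seq bintree) :
  (Node l r \in [seq Node l0 r' | r' <- s]) = (l == l0) && (r \in s).
Proof.
apply/mapP/andP => [[r' s_r' [-> ->]]|[/eqP-> s_r]]; first by [].
by exists r.
Qed.

Lemma mem_moves_Node l r l' r' :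
  (Node l' r' \in moves (Node l r)) =
  [|| Node l' r' \in root_moves l r,
      (l' \in moves l) && (r' == r) | (l' == l) && (r' \in moves r)].
Proof. by rewrite !mem_cat mem_Node_left mem_Node_right. Qed.

Lemma Leaf_moves t : Leaf \notin moves t.
Proof.
case: t => // l r; rewrite /= !mem_cat !negb_or Leaf_root_moves /=.
by apply/andP; split; apply/mapP => -[].
Qed.

Lemma moves_irreflexive t : t \notin moves t.
Proof.
elim: t => // l IHl r IHr.
rewrite mem_moves_Node (negbTE IHl) (negbTE IHr) andbF /= orbF.
by apply/negP => /root_moves_proper; rewrite eqxx.
Qed.

(** Moves at the root, in the left subtree and in the right subtree give
    different results: a root move changes both subtrees of the root, the other
    two kinds change exactly one of them. *)
Lemma uniq_moves t : uniq (moves t).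
Proof.
elim: t => // l IHl r IHr /=.
rewrite !cat_uniq !map_inj_uniq ?IHl ?IHr; try by move=> ? ? [].
rewrite andbT /=; apply/and3P; split.
- have := size_root_moves l r; case: (root_moves l r) => [|x [|y s]] //=.
  by case: (edge l r).
- apply/hasPn => -[|l' r'].
    by rewrite mem_cat => /orP[] /mapP[].
  rewrite mem_cat mem_Node_left mem_Node_right => eq_lr; apply/negP.
  case/root_moves_proper/andP=> /negbTE neq_l /negbTE neq_r.
  by rewrite neq_l neq_r andbF in eq_lr.
- apply/hasPn => _ /mapP[r' r_r' ->] /=.
  by rewrite mem_Node_left (negbTE (moves_irreflexive l)).
Qed.

Lemma size_moves t : size (moves t) = count_edges edge t.
Proof.
by elim: t => //= l IHl r IHr; rewrite !size_cat !size_map IHl IHr addnA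
  size_root_moves.
Qed.

Lemma card_moves n (P : pred bintree) t :
    (forall u, P u = (u \in moves t)) ->
    (forall u, u \in moves t -> nodes u = n) ->
  #|[set S : Tam n | P (val S)]| = count_edges edge t.
Proof.
move=> P_moves nodes_moves; rewrite cardsE cardE -(size_map val) -size_moves.
apply/perm_size/perm_map_enum => [||u|u t_u].
- exact: val_inj.
- exact: uniq_moves.
- by rewrite -P_moves.
- by exists (exist _ u (introT eqP (nodes_moves u t_u))).
Qed.

End Moves.

Definition root_rotations (l r : bintree) : seq bintree :=
  if l is Node a b then [:: Node a (Node b r)] else [::].

Definition root_unrotations (l r : bintree) : seq bintree :=
  if r is Node b c then [:: Node (Node l b) c] else [::].

Lemma Node_neq_left l r : (l == Node l r) = false.
Proof. by elim: l r => // a IHa b _ r; rewrite eq_Node IHa. Qed.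

Lemma Node_neq_right l r : (r == Node l r) = false.
Proof. by elim: r l => // a _ b IHb l; rewrite eq_Node IHb andbF. Qed.

Lemma root_rotations_proper l r l' r' :
  Node l' r' \in root_rotations l r -> (l' != l) && (r' != r).
Proof.
case: l => //= a b; rewrite inE => /eqP[-> ->].
by rewrite Node_neq_left eq_sym Node_neq_right.
Qed.

Lemma root_unrotations_proper l r l' r' :
  Node l' r' \in root_unrotations l r -> (l' != l) && (r' != r).
Proof.
case: r => //= a b; rewrite inE => /eqP[-> ->].
by rewrite Node_neq_right eq_sym Node_neq_left.
Qed.

Lemma size_root_rotations l r : size (root_rotations l r) = left_edge l r.
Proof. by case: l. Qed.

Lemma size_root_unrotations l r : size (root_unrotations l r) = right_edge l r.
Proof. by case: r. Qed.

Lemma Leaf_root_rotations l r : Leaf \notin root_rotations l r.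
Proof. by case: l. Qed.

Lemma Leaf_root_unrotations l r : Leaf \notin root_unrotations l r.
Proof. by case: r. Qed.

Lemma mem_rotations t u : rotation t u = (u \in moves root_rotations t).
Proof.
elim: t u => [|l IHl r IHr] [|l' r'] //.
  by rewrite (negbTE (Leaf_moves Leaf_root_rotations _)).
rewrite mem_moves_Node /= IHl IHr [l == l']eq_sym [r == r']eq_sym.
by congr (_ || _); case: l {IHl} => //= a b; rewrite inE eq_Node.
Qed.

Lemma mem_unrotations t u : rotation t u = (t \in moves root_unrotations u).
Proof.
elim: u t => [|l IHl r IHr] [|l' r'] //.
  by rewrite (negbTE (Leaf_moves Leaf_root_unrotations _)).
rewrite mem_moves_Node /= IHl IHr; congr (_ || _).
case: l' => [|a b]; case: r {IHr} => [|b' c'] //=; last first.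
  rewrite inE !eq_Node -andbA [l == a]eq_sym [b' == b]eq_sym.
  by rewrite [c' == r']eq_sym.
by rewrite [_ == Node b r']eq_sym andbF.
Qed.

Lemma asc_left_edges n (T : Tam n) : asc T = count_edges left_edge (val T).
Proof.
apply: (card_moves size_root_rotations root_rotations_proper
  Leaf_root_rotations (P := rotation (val T))) => u.
  exact: mem_rotations.
by rewrite -mem_rotations => /nodes_rotation <-; apply/eqP/(valP T).
Qed.

Lemma des_right_edges n (T : Tam n) : des T = count_edges right_edge (val T).
Proof.
apply: (card_moves size_root_unrotations root_unrotations_proper
  Leaf_root_unrotations (P := fun t => rotation t (val T))) => u.
  exact: mem_unrotations.
by rewrite -mem_unrotations => /nodes_rotation ->; apply/eqP/(valP T).
Qed.

(** * Faces with a prescribed extremal vertex *)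

(** The number of edge contractions that lead from a binary tree to [s], which is
    the dimension of the face: a node with p children absorbs p - 2 of them.
    Being additive over the subtrees, it suits recursion better than
    [face_dim]. *)
Fixpoint excess (s : stree) : nat :=
  if s is SNode s1 s2 ss then
    excess s1 + excess s2 + sumn (map excess ss) + size ss
  else 0.

Lemma excess_internal_nodes s : leaves s = (excess s + internal_nodes s).+1.
Proof.
elim/stree_ind_mem: s => //= s1 s2 ss -> -> IHss.
have -> : sumn (map leaves ss)
    = sumn (map excess ss) + sumn (map internal_nodes ss) + size ss.
  elim: ss IHss => //= s ss IH IHss; rewrite IHss ?mem_head // IH.
    by rewrite addSn addnS; congr _.+1; rewrite addnA [in RHS]addnACA.
  by move=> u ss_u; apply: IHss; rewrite inE ss_u orbT.
rewrite addSn addnS !addSn addnS; congr _.+2.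
by rewrite (addnACA (excess s1)) (addnAC (sumn _)) addnACA [in LHS](addnA (_ + _) (sumn _)).
Qed.

Lemma face_dimE d (F : assoc_face d) : face_dim F = excess (val F).
Proof.
rewrite /face_dim; case: F => s /= /eqP.
by rewrite excess_internal_nodes => -[<-]; rewrite addnK.
Qed.

Lemma eq_SNode s1 s2 ss t1 t2 ts :
  (SNode s1 s2 ss == SNode t1 t2 ts) = [&& s1 == t1, s2 == t2 & ss == ts].
Proof.
by apply/eqP/and3P => [[-> -> ->]|[/eqP-> /eqP-> /eqP->]].
Qed.

(** [vertex] stands for [max_tree] or [min_tree]. A Schroeder tree with at least
    one internal node determines, through [split], two Schroeder trees whose
    vertices are the left and right subtrees of its own vertex; [merge s1 s2] lists the
    trees with [split] equal to (s1, s2): the root edge is either kept, or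
    contracted if it exists. *)
Section Fiber.

Variables (vertex : stree -> bintree) (merge : stree -> stree -> seq stree).
Variables (split : stree -> stree * stree) (edge : bintree -> bintree -> bool).

Hypothesis vertex_leaf : vertex SLeaf = Leaf.
Hypothesis vertex_split : forall s, s != SLeaf ->
  vertex s = Node (vertex (split s).1) (vertex (split s).2).
Hypothesis count_merge : forall s s1 s2,
  count_mem s (merge s1 s2) = (s != SLeaf) && (split s == (s1, s2)).
Hypothesis sum_merge : forall s1 s2,
  (\sum_(s <- merge s1 s2) 'X^(excess s)
     = 'X^(excess s1) * 'X^(excess s2)
         * (1 + 'X) ^+ edge (vertex s1) (vertex s2) :> {poly nat})%R.

Fixpoint fiber (t : bintree) : seq stree :=
  if t is Node l r then
    flatten [seq merge s1 s2 | s1 <- fiber l, s2 <- fiber r]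
  else [:: SLeaf].

(** A single count gives both that [fiber t] has no repetition and that it
    consists of the trees with vertex [t]. *)
Lemma count_fiber s t : count_mem s (fiber t) = (vertex s == t).
Proof.
elim: t s => [|l IHl r IHr] s /=.
  rewrite addn0 eq_sym; have [->|s_node] := eqVneq s SLeaf.
    by rewrite vertex_leaf.
  by rewrite vertex_split.
rewrite -sum1_count big_flatten big_allpairs_dep /=.
under eq_bigr => s1 _ do under eq_bigr => s2 _ do
  rewrite sum1_count count_merge.
have [->|s_node] := eqVneq s SLeaf.
  by rewrite vertex_leaf big1 // => s1 _; rewrite big1.
rewrite vertex_split // eq_Node -mulnb -IHl -IHr.
rewrite -!sum1_count (big_mkcond (pred1 _)) [X in _ * X]big_mkcond /=.
rewrite big_distrlr; apply: eq_bigr => s1 _; apply: eq_bigr => s2 _ /=.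
case: (split s) => p1 p2 /=; rewrite xpair_eqE [p1 == _]eq_sym [p2 == _]eq_sym.
by case: (s1 == p1); case: (s2 == p2).
Qed.

Lemma fiber_vertex s t : s \in fiber t -> vertex s = t.
Proof. by rewrite -has_pred1 has_count count_fiber lt0b => /eqP. Qed.

(** By [sum_merge] each edge contributes a factor 1 + X: the term 1 when it is
    kept, the term X when it is contracted. *)
Lemma fiber_polynomial t :
  (\sum_(s <- fiber t) 'X^(excess s) = (1 + 'X) ^+ count_edges edge t
     :> {poly nat})%R.
Proof.
elim: t => [|l IHl r IHr] /=; first by rewrite big_seq1 !expr0.
rewrite big_flatten big_allpairs_dep -addnA addnC !exprD -IHl -IHr.
rewrite big_distrlr big_distrl !big_seq /=.
apply: eq_bigr => s1 /fiber_vertex v1; rewrite big_distrl !big_seq /=.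
by apply: eq_bigr => s2 /fiber_vertex v2; rewrite sum_merge v1 v2.
Qed.

Lemma sum_fiber d (t : bintree) : nodes t = d.+1 ->
    (forall s, (nodes (vertex s)).+1 = leaves s) ->
  (\sum_(F : assoc_face d | vertex (val F) == t) 'X^(face_dim F)
     = (1 + 'X) ^+ count_edges edge t :> {poly nat})%R.
Proof.
move=> t_nodes vertex_nodes; rewrite -fiber_polynomial.
under eq_bigr => F _ do rewrite face_dimE.
rewrite -big_enum -(big_map val predT (fun s => 'X^(excess s))%R).
have mem_fiber s : (s \in fiber t) = (vertex s == t).
  by rewrite -has_pred1 has_count count_fiber lt0b.
apply/perm_big/(perm_map_enum (Q := fun s => vertex s == t)) => [||//|s].
- exact: val_inj.
- by apply: count_mem_uniq => s; rewrite count_fiber mem_fiber.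
rewrite mem_fiber => /eqP s_t.
have sd : leaves s == d.+2 by rewrite -vertex_nodes s_t t_nodes.
by exists (exist _ s sd).
Qed.

End Fiber.

(** Contracting the edge from the root to its right child puts the children of
    the latter at the end of the list of children of the root. *)
Definition right_merge (s1 s2 : stree) : seq stree :=
  SNode s1 s2 [::]
    :: (if s2 is SNode a b ss then [:: SNode s1 a (b :: ss)] else [::]).

Definition right_split (s : stree) : stree * stree :=
  match s with
  | SLeaf => (SLeaf, SLeaf)
  | SNode s1 s2 [::] => (s1, s2)
  | SNode s1 s2 (u :: us) => (s1, SNode s2 u us)
  end.

(** Contracting the edge from the root to its left child puts the children of the
    latter at the beginning, so that [s2] becomes the last child. *)
Definition left_merge (s1 s2 : stree) : seq stree :=
  SNode s1 s2 [::]
    :: (if s1 is SNode a b ss then [:: SNode a b (rcons ss s2)] else [::]).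

Definition left_split (s : stree) : stree * stree :=
  match s with
  | SLeaf => (SLeaf, SLeaf)
  | SNode s1 s2 [::] => (s1, s2)
  | SNode s1 s2 (u :: us) => (SNode s1 s2 (belast u us), last u us)
  end.

Lemma left_split_rcons s1 s2 ss u :
  left_split (SNode s1 s2 (rcons ss u)) = (SNode s1 s2 ss, u).
Proof. by case: ss => //= v ss; rewrite belast_rcons last_rcons. Qed.

Lemma max_tree_split s : s != SLeaf ->
  max_tree s = Node (max_tree (right_split s).1) (max_tree (right_split s).2).
Proof. by case: s => // s1 s2 []. Qed.

Lemma min_tree_split s : s != SLeaf ->
  min_tree s = Node (min_tree (left_split s).1) (min_tree (left_split s).2).
Proof.
case: s => // s1 s2 ss _; case/lastP: ss => // ss u.
by rewrite left_split_rcons /= /left_comb map_rcons /= foldl_rcons.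
Qed.

Lemma count_right_merge s s1 s2 :
  count_mem s (right_merge s1 s2) = (s != SLeaf) && (right_split s == (s1, s2)).
Proof.
case: s => [|a b ss]; first by case: s2.
rewrite /= eq_SNode; case: ss => [|u us]; case: s2 => [|a' b' ss'] /=;
  rewrite ?eq_SNode ?xpair_eqE ?eq_SNode ?eqseq_cons ?andbT ?andbF ?addn0 //=.
- by rewrite [a == _]eq_sym [b == _]eq_sym.
- by rewrite [a == _]eq_sym [b == _]eq_sym.
- by rewrite [a == _]eq_sym [b == _]eq_sym [u == _]eq_sym [us == _]eq_sym.
Qed.

Lemma count_left_merge s s1 s2 :
  count_mem s (left_merge s1 s2) = (s != SLeaf) && (left_split s == (s1, s2)).
Proof.
case: s => [|a b ss]; first by case: s1.
case/lastP: ss => [|us u]; rewrite ?left_split_rcons /= ?eq_SNode;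
  case: s1 => [|a' b' ss'] /=;
  rewrite ?eq_SNode ?xpair_eqE ?eq_SNode ?eqseq_rcons ?andbT ?andbF ?addn0 //=.
- by rewrite [a == _]eq_sym [b == _]eq_sym.
- by case: ss' => [|? ?]; rewrite !andbF addn0 [a == _]eq_sym [b == _]eq_sym.
- by case: us => [|? ?]; rewrite !andbF.
- rewrite [a == _]eq_sym [b == _]eq_sym [u == _]eq_sym [us == _]eq_sym.
  by case: us => [|? ?]; rewrite !andbF add0n !andbA.
Qed.

Lemma sum_right_merge s1 s2 :
  (\sum_(s <- right_merge s1 s2) 'X^(excess s)
     = 'X^(excess s1) * 'X^(excess s2)
         * (1 + 'X) ^+ right_edge (max_tree s1) (max_tree s2) :> {poly nat})%R.
Proof.
rewrite /right_merge /right_edge big_cons /= !addn0 -exprD.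
case: s2 => [|a b ss] /=; first by rewrite big_nil addr0 mulr1.
rewrite big_seq1 expr1 mulrDr mulr1 -exprSr; congr (_ + 'X^_)%R => /=.
by rewrite addnS !addnA.
Qed.

Lemma sum_left_merge s1 s2 :
  (\sum_(s <- left_merge s1 s2) 'X^(excess s)
     = 'X^(excess s1) * 'X^(excess s2)
         * (1 + 'X) ^+ left_edge (min_tree s1) (min_tree s2) :> {poly nat})%R.
Proof.
rewrite /left_merge /left_edge big_cons /= !addn0 -exprD.
case: s1 => [|a b ss]; first by rewrite big_nil addr0 mulr1.
rewrite min_tree_split // expr1 mulrDr mulr1 -exprSr big_seq1.
congr (_ + 'X^_)%R => /=.
rewrite map_rcons sumn_rcons size_rcons addnS; congr _.+1.
by rewrite addnA addnAC.
Qed.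

Lemma sum_face_max d (S : Tam d.+1) :
  (\sum_(F : assoc_face d | face_max F == S) 'X^(face_dim F)
     = (1 + 'X) ^+ des S :> {poly nat})%R.
Proof.
rewrite des_right_edges -(sum_fiber (erefl Leaf) max_tree_split
  count_right_merge sum_right_merge (eqP (valP S)) nodes_max_tree).
exact: eq_bigl.
Qed.

Lemma sum_face_min d (T : Tam d.+1) :
  (\sum_(F : assoc_face d | face_min F == T) 'X^(face_dim F)
     = (1 + 'X) ^+ asc T :> {poly nat})%R.
Proof.
rewrite asc_left_edges -(sum_fiber (erefl Leaf) min_tree_split
  count_left_merge sum_left_merge (eqP (valP T)) nodes_min_tree).
exact: eq_bigl.
Qed.

(** * The f-polynomial of the diagonal *)

Lemma diag_polynomial d :
  (\sum_(C : diag_face d) 'X^(diag_dim C)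
     = \sum_(I : Tam d.+1 * Tam d.+1 | (I.1 <= I.2)%O)
          (1 + 'X) ^+ (des I.1 + asc I.2) :> {poly nat})%R.
Proof.
pose P : {pred assoc_face d * assoc_face d} :=
  fun FG => (face_max FG.1 <= face_min FG.2)%O.
rewrite /diag_dim -(big_sub P (fun FG => 'X^(face_dim FG.1 + face_dim FG.2))%R).
rewrite (partition_big (fun FG => (face_max FG.1, face_min FG.2))
  (fun I : Tam d.+1 * Tam d.+1 => (I.1 <= I.2)%O)) //=.
apply: eq_bigr => -[S T] /= leST.
(* for a given interval, the sum over the pairs (F, G) is a product *)
rewrite exprD -sum_face_max -sum_face_min big_distrlr pair_big /=.
apply: eq_big => [[F G]|[F G] _]; last by rewrite exprD.
rewrite xpair_eqE /= unfold_in /P /=.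
(* the condition max F <= min G follows from S <= T *)
by apply: andb_idl => /andP[/eqP-> /eqP->].
Qed.

Lemma coef_exp1X e k : (((1 + 'X) ^+ e : {poly nat})`_k)%R = 'C(e, k).
Proof.
rewrite addrC exprD1n coef_sum.
under eq_bigr => i _ do rewrite coefMn coefXn.
have [lt_ke|le_ek] := ltnP k e.+1.
  rewrite (bigD1 (Ordinal lt_ke)) //= eqxx natn big1 ?addr0 // => i.
  by rewrite -val_eqE /= eq_sym => /negbTE->; rewrite mul0rn.
rewrite bin_small // big1 // => i _.
by rewrite gtn_eqF ?mul0rn // (leq_trans (ltn_ord i)).
Qed.

Theorem proposition7 (n : nat) (hn : 1 <= n) :
  diag_fvector n.-1 = mkseq (tamari_b n) n.
Proof.
case: n hn => // d _; apply: eq_mkseq => k.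
have := congr1 (fun p : {poly nat} => p`_k)%R (diag_polynomial d).
rewrite /tamari_b !coef_sum => /esym; under eq_bigr do rewrite coef_exp1X.
move=> ->; rewrite cardsE -sum1_card [LHS]big_mkcond.
apply: eq_bigr => C _; rewrite coefXn eq_sym -[C \in _]/(diag_dim C == k).
by case: (diag_dim C == k).
Qed.
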